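(* There is a reduction from computing $\epsilon$-approximate Nash equilibria of $n$-player, binary-action, $\Lambda$-Multi-Lipschitz games with probability at least $1-\eta$ to computing $\frac{\epsilon}{2}$-approximate Nash equilibria of $2n$-player, binary-action, $\frac{3\Lambda}{2n}$-Lipschitz games with probability at least $1-\frac{\eta}{2}$, introducing at most a multiplicative $\mathrm{poly}\left(n,\frac1\epsilon,\log\frac1\eta\right)$ query blowup.
   Context: Games. An $n$-player binary-action game has players $[n]=\{1,\dots,n\}$, each with action set $\{1,2\}$, and payoff functions $u_i:\{1,2\}^n\to[0,1]$, extended to mixed strategy profiles $\mathbf{p}=(p_1,\dots,p_n)$ (independent randomization by the players) by expectation; $u_i(j,\mathbf{p}_{-i})$ is player $i$'s expected payoff for playing action $j$ when the others play according to $\mathbf{p}$. For a pure action profile $\mathbf{a}$, $\mathbf{a}_{-i}$ denotes the actions of all players other than $i$. Lipschitz games. For $\lambda\in(0,1]$, a game is $\lambda$-Lipschitz if a change in strategy of any given player can affect the payoff of any other player by at most an additive $\lambda$; i.e. for every player $i$ and all pure action profiles $\mathbf{a},\mathbf{a}'$ with $a_i=a_i'$, $|u_i(\mathbf{a})-u_i(\mathbf{a}')|\le\lambda\|\mathbf{a}_{-i}-\mathbf{a}'_{-i}\|_1$. Multi-Lipschitz games. A $\Lambda$-Multi-Lipschitz game is a game in which each player $i\in[n]$ is associated with a constant $\lambda_i\le1$ such that $\sum_{i=1}^n\lambda_i=\Lambda$ and, for any player $i'\ne i$ and any pure action profiles $\mathbf{a}^{(1)},\mathbf{a}^{(2)}$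 with $\mathbf{a}^{(1)}_{-i}=\mathbf{a}^{(2)}_{-i}$, $|u_{i'}(\mathbf{a}^{(1)})-u_{i'}(\mathbf{a}^{(2)})|\le\lambda_i$. For simplicity it is assumed that $\lambda_1\le\dots\le\lambda_n$. Equilibria. $\mathbf{p}$ is an $\epsilon$-approximate Nash equilibrium if $\max_{j}u_i(j,\mathbf{p}_{-i})-u_i(\mathbf{p})\le\epsilon$ for every player $i$. Queries. Algorithms (which may be randomized) access a game through profile queries: a profile query of a pure action profile $\mathbf{a}$ returns the vector of payoffs $u_i(\mathbf{a})$ of all players $i$. The query complexity of an algorithm is the number of profile queries it makes. $\mathrm{poly}(\cdot)$ denotes a polynomial in the listed quantities. *)

(* Defs.v *)
From HB Require Import structures.
From mathcomp Require Import all_boot all_order all_algebra.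
From mathcomp Require Import all_classical all_reals all_analysis.
(* Not imported: its notations clash with those of MathComp-Analysis. *)
From mathcomp Require mpoly.

Set Implicit Arguments.
Unset Strict Implicit.
Unset Printing Implicit Defensive.

Import Order.TTheory GRing.Theory Num.Theory.

Local Open Scope classical_set_scope.
Local Open Scope ring_scope.

(* The actions 1 and 2 are encoded as the elements 0 and 1 of 'I_2. *)
Definition profile (n : nat) := {ffun 'I_n -> 'I_2}.

Definition payoffs (R : realType) (n : nat) := 'I_n -> profile n -> R.

Definition is_game (R : realType) (n : nat) (u : payoffs R n) : Prop :=
  forall i a, 0 <= u i a <= 1.

(* [p i] is the probability that player [i] plays the second action. *)
Definition strategies (R : realType) (n : nat) := 'I_n -> R.

Definition is_mixed (R : realType) (n : nat) (p : strategies R n) : Prop :=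
  forall i, 0 <= p i <= 1.

Definition prob_action (R : realType) (x : R) (j : 'I_2) : R :=
  if j == ord0 then 1 - x else x.

Definition expected_payoff (R : realType) (n : nat) (u : payoffs R n)
    (i : 'I_n) (p : strategies R n) : R :=
  \sum_(a : profile n) (\prod_(k < n) prob_action (p k) (a k)) * u i a.

(* The profile (j, p_{-i}). *)
Definition deviate (R : realType) (n : nat) (p : strategies R n)
    (i : 'I_n) (j : 'I_2) : strategies R n :=
  fun k => if k == i then (j : nat)%:R else p k.

Definition approx_nash (R : realType) (n : nat) (u : payoffs R n) (eps : R)
    (p : strategies R n) : Prop :=
  is_mixed p /\
  forall i : 'I_n,
    Num.max (expected_payoff u i (deviate p i ord0))
            (expected_payoff u i (deviate p i ord_max))
      - expected_payoff u i p <= eps.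

(* No upper bound is put on [lambda]: for [1 <= lambda] the condition holds for
   every game with payoffs in [0, 1]. *)
Definition lipschitz_game (R : realType) (n : nat) (lambda : R)
    (u : payoffs R n) : Prop :=
  is_game u /\
  forall (i : 'I_n) (a a' : profile n), a i = a' i ->
    `|u i a - u i a'|
      <= lambda * \sum_(k < n | k != i) `|(a k : nat)%:R - (a' k : nat)%:R|.

Definition multi_lipschitz_game (R : realType) (n : nat) (Lambda : R)
    (lam : 'I_n -> R) (u : payoffs R n) : Prop :=
  [/\ is_game u,
      forall i, lam i <= 1,
      \sum_(i < n) lam i = Lambda,
      forall i j : 'I_n, (i <= j)%N -> lam i <= lam j &
      forall (i i' : 'I_n) (a1 a2 : profile n), i' != i ->
        (forall k, k != i -> a1 k = a2 k) ->
        `|u i' a1 - u i' a2| <= lam i].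

(* A deterministic algorithm: adaptive profile queries, each answered by the
   payoffs of all the players, followed by the output of a mixed profile. *)
Inductive query_tree (R : realType) (n : nat) : Type :=
| Output of strategies R n
| Query of profile n & (('I_n -> R) -> query_tree R n).

Fixpoint output (R : realType) (n : nat) (t : query_tree R n)
    (u : payoffs R n) : strategies R n :=
  match t with
  | Output p => p
  | Query a next => output (next (fun i => u i a)) u
  end.

Fixpoint num_queries (R : realType) (n : nat) (t : query_tree R n)
    (u : payoffs R n) : nat :=
  match t with
  | Output _ => 0%N
  | Query a next => (num_queries (next (fun i => u i a)) u).+1
  end.

(* A randomized algorithm is a probability distribution over deterministic ones;
   on every game, its output and its number of queries are random variables. *)
Record rand_algorithm (R : realType) (n : nat) := RandAlgorithm {
  ra_display : measure_display;
  ra_space : measurableType ra_display;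
  ra_prob : probability ra_space R;
  ra_tree : ra_space -> query_tree R n;
  ra_output_measurable : forall u : payoffs R n, is_game u ->
    forall i : 'I_n, measurable_fun setT (fun w => output (ra_tree w) u i);
  ra_queries_measurable : forall u : payoffs R n, is_game u ->
    measurable_fun setT (fun w => num_queries (ra_tree w) u) }.

Definition computes_nash (R : realType) (n : nat) (C : payoffs R n -> Prop)
    (eps delta q : R) (A : rand_algorithm R n) : Prop :=
  forall u, C u ->
    (forall w : ra_space A, (num_queries (ra_tree w) u)%:R <= q) /\
    ((1 - delta)%:E
      <= ra_prob A [set w | approx_nash u eps (output (ra_tree w) u)])%E.

(* Algorithms for multi-Lipschitz games are given the constants of the players. *)
Definition computes_nash_multi_lipschitz (R : realType) (n : nat)
    (Lambda eps delta q : R) (B : ('I_n -> R) -> rand_algorithm R n) : Prop :=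
  forall lam : 'I_n -> R,
    computes_nash (multi_lipschitz_game Lambda lam) eps delta q (B lam).

Definition eval3 (R : realType) (P : mpoly.mpoly 3 R) (x y z : R) : R :=
  mpoly.meval (tnth [tuple x; y; z]) P.

(* Main.v *)
(* Replace player [i] by a group of at least [n lam_i / Lambda] players, [2 n] in
   all.  Members of a group receive the payoff [u_i] gives to their own action
   against the average behaviour of the other groups; one member shifts the
   average by the inverse of the size of the group, so the population game is
   [Lambda / n]-Lipschitz.  Averaging an approximate equilibrium over the groups
   gives one of the original game, since payoffs are affine in each strategy.

   The population payoffs are estimated by sampling a representative of each
   group.  All the samples are drawn beforehand and serve every query, so the
   answers come from one fixed game.  By a Chernoff bound and a union bound over
   the [2 ^ (2 n)] profiles, polynomially many samples approximate all payoffs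
   at once with high probability, and whether the estimated game is
   [3 Lambda / (2 n)]-Lipschitz depends only on how often each representative is
   drawn.  When it is not, or when [Lambda <= eps / 4], the game in which
   everybody is supposed to play like oneself is used instead: it is 0-Lipschitz
   and within [Lambda] of the population game. *)
From HB Require Import structures.
Require Import Defs.
From mathcomp Require Import all_boot all_order all_algebra.
From mathcomp Require Import all_classical all_reals all_analysis.
From mathcomp Require mpoly.
From mathcomp Require Import measurable_realfun ring lra zify.

Import Order.TTheory GRing.Theory Num.Theory.
Local Open Scope ring_scope.

Set Implicit Arguments.
Unset Strict Implicit.
Unset Printing Implicit Defensive.

(** * Mixed strategies and populations *)

Lemma prob_action_sum (R : realType) (x : R) : \sum_(j < 2) prob_action x j = 1.
Proof. by rewrite !big_ord_recl big_ord0 /prob_action /= addr0 subrK. Qed.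

Lemma prob_action_ge0 (R : realType) (x : R) j :
  0 <= x <= 1 -> 0 <= prob_action x j.
Proof. by case/andP=> x0 x1; rewrite /prob_action; case: ifP; rewrite ?subr_ge0. Qed.

Definition update (R : realType) n (p : strategies R n) (i : 'I_n) (x : R) :
  strategies R n := fun k => if k == i then x else p k.

Lemma profile_prob_sum (R : realType) n (p : strategies R n) :
  \sum_(a : profile n) \prod_(k < n) prob_action (p k) (a k) = 1.
Proof.
rewrite -(bigA_distr_bigA (fun k j => prob_action (p k) j)).
by rewrite big1 // => k _; exact: prob_action_sum.
Qed.

Lemma profile_prob_ge0 (R : realType) n (p : strategies R n) (a : profile n) :
  is_mixed p -> 0 <= \prod_(k < n) prob_action (p k) (a k).
Proof. by move=> pmix; apply: prodr_ge0 => k _; apply: prob_action_ge0. Qed.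

(** Only one factor of the product law depends on [x], and that factor is affine in [x]. *)
Lemma expected_payoff_update (R : realType) n (u : payoffs R n) i0 i
    (p : strategies R n) x :
  expected_payoff u i0 (update p i x) =
    (1 - x) * expected_payoff u i0 (update p i 0)
    + x * expected_payoff u i0 (update p i 1).
Proof.
rewrite /expected_payoff !mulr_sumr -big_split; apply: eq_bigr => a _ /=.
have split_i y : \prod_(k < n) prob_action (update p i y k) (a k) =
    prob_action y (a i) * \prod_(k < n | k != i) prob_action (p k) (a k).
  rewrite (bigD1 i) //= {1}/update eqxx; congr (_ * _).
  by apply: eq_bigr => k /negPf ki; rewrite /update ki.
rewrite !split_i /prob_action; case: ifP => _; ring.
Qed.

Lemma expected_payoff_close (R : realType) n (u v : payoffs R n) i
    (p : strategies R n) (d : R) :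
  is_mixed p -> (forall a, `|u i a - v i a| <= d) ->
  `|expected_payoff u i p - expected_payoff v i p| <= d.
Proof.
move=> pmix uv; rewrite /expected_payoff -sumrB.
apply: le_trans (ler_norm_sum _ _ _) _.
rewrite -[leRHS]mul1r -[X in X * d](profile_prob_sum p) mulr_suml; apply: ler_sum => a _.
rewrite -mulrBr normrM ger0_norm ?profile_prob_ge0 //.
by rewrite ler_wpM2l ?profile_prob_ge0.
Qed.

(* The actions of distinct players are independent, so restricting a random
   profile along a section of [g] again gives a product distribution. *)
Lemma expected_payoff_section (R : realType) n M (u : payoffs R n) i
    (g : 'I_M -> 'I_n) (tau : 'I_n -> 'I_M) (q : strategies R M) :
  cancel tau g ->
  \sum_(b : profile M)
     (\prod_(m < M) prob_action (q m) (b m)) * u i [ffun k => b (tau k)] =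
  expected_payoff u i (q \o tau).
Proof.
move=> tauK.
rewrite (partition_big
  (fun b : profile M => [ffun k => b (tau k)] : profile n) xpredT) //=.
apply: eq_bigr => a _.
under eq_bigr => b /eqP -> do [].
rewrite -mulr_suml; congr (_ * _).
(* [tau (g m) == m] says that [m] lies in the image of [tau]: there the action is prescribed;
   elsewhere it is free and its probabilities sum to 1. *)
pose Q m := [pred j : 'I_2 | (tau (g m) == m) ==> (j == a (g m))].
transitivity (\sum_(b in family Q) \prod_(m < M) prob_action (q m) (b m)).
  apply: eq_bigl => b; apply/eqP/familyP => [ba m | bQ].
    by rewrite !inE -ba ffunE; apply/implyP => /eqP ->.
  apply/ffunP => k; rewrite ffunE.
  by have := bQ (tau k); rewrite !inE tauK eqxx => /eqP ->.
rewrite -(bigA_distr_big_dep Q (fun m j => prob_action (q m) j)).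
transitivity (\prod_(m < M | tau (g m) == m) prob_action (q m) (a (g m))).
  rewrite [RHS]big_mkcond; apply: eq_bigr => m _; rewrite /Q.
  case: ifP => _ /=; last by rewrite prob_action_sum.
  by rewrite big_pred1_eq.
rewrite (reindex_onto tau g) => [|m /eqP //].
by apply: eq_big => [k|k _]; rewrite tauK ?eqxx.
Qed.

(** Drawing an index independently for each player and playing the corresponding strategy amounts to
    playing the mean strategy: [prob_action] is affine and products distribute over sums. *)
Lemma expected_payoff_mix (R : realType) n M (u : payoffs R n) i0
    (w r : 'I_n -> 'I_M -> R) :
  (forall i, \sum_m w i m = 1) ->
  \sum_(s : {ffun 'I_n -> 'I_M})
     (\prod_(i < n) w i (s i)) * expected_payoff u i0 (fun i => r i (s i)) =
  expected_payoff u i0 (fun i => \sum_m w i m * r i m).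
Proof.
move=> w1; rewrite /expected_payoff.
under eq_bigr do rewrite mulr_sumr.
rewrite exchange_big; apply: eq_bigr => a _ /=.
under eq_bigr do rewrite mulrA -big_split.
rewrite -mulr_suml; congr (_ * _).
rewrite -(bigA_distr_bigA (fun i m => w i m * prob_action (r i m) (a i))).
apply: eq_bigr => i _; rewrite /prob_action; case: ifP => _ //.
by under eq_bigr do rewrite mulrBr mulr1; rewrite sumrB w1.
Qed.

Section Population.
Variables (R : realType) (n M : nat) (g : 'I_M -> 'I_n).
Hypothesis g_surj : forall i, (0 < #|[set m | g m == i]|)%N.

Definition fiber_weight (i : 'I_n) (m : 'I_M) : R :=
  if g m == i then #|[set m | g m == i]|%:R^-1 else 0.

Lemma fiber_weight_ge0 i m : 0 <= fiber_weight i m.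
Proof. by rewrite /fiber_weight; case: ifP => // _; rewrite invr_ge0. Qed.

Lemma fiber_weight_sum i : \sum_m fiber_weight i m = 1.
Proof.
rewrite /fiber_weight -big_mkcond (eq_bigl (fun m => m \in [set m | g m == i])) => [|m].
  by rewrite sumr_const -[LHS]mulr_natr mulVf // pnatr_eq0 -lt0n g_surj.
by rewrite inE.
Qed.

Definition fiber_average (p : strategies R M) : strategies R n :=
  fun i => \sum_m fiber_weight i m * p m.

Lemma fiber_average_mixed p : is_mixed p -> is_mixed (fiber_average p).
Proof.
move=> pmix i; apply/andP; split.
  apply: sumr_ge0 => m _; rewrite mulr_ge0 ?fiber_weight_ge0 //.
  by case/andP: (pmix m).
rewrite -(fiber_weight_sum i); apply: ler_sum => m _.
rewrite ler_piMr ?fiber_weight_ge0 //.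
by case/andP: (pmix m).
Qed.

(** The law of one uniform representative per group, drawn independently over the groups; it is
    supported on sections of [g]. *)
Definition section_weight (s : {ffun 'I_n -> 'I_M}) : R :=
  \prod_(i < n) fiber_weight i (s i).

Lemma section_weight_ge0 s : 0 <= section_weight s.
Proof. by apply: prodr_ge0 => i _; exact: fiber_weight_ge0. Qed.

Lemma section_weight_sum : \sum_s section_weight s = 1.
Proof.
rewrite -(bigA_distr_bigA fiber_weight) big1 // => i _.
exact: fiber_weight_sum.
Qed.

Lemma section_weight_section s : section_weight s != 0 -> cancel s g.
Proof.
move=> /prodf_neq0 sw i; have := sw i isT; rewrite /fiber_weight.
by case: (g (s i) =P i) => // _; rewrite eqxx.
Qed.

(** Player [i] plays [j] whatever its representative does, so a member is paid for its own action
    and is not influenced by the rest of its group. *)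
Definition sampled_profile (s : {ffun 'I_n -> 'I_M}) (b : profile M)
    (i : 'I_n) (j : 'I_2) : profile n :=
  [ffun k => if k == i then j else b (s k)].

Definition population_payoff (u : payoffs R n) : payoffs R M := fun k b =>
  \sum_s section_weight s * u (g k) (sampled_profile s b (g k) (b k)).

(** For a fixed section the representatives are distinct players, so the sampled profile has a
    product law; averaging over the sections then replaces the strategy of every other group by its
    mean. *)
Lemma expected_population_payoff u k q :
  expected_payoff (population_payoff u) k q =
  expected_payoff u (g k) (update (fiber_average q) (g k) (q k)).
Proof.
pose r i m := if i == g k then q k else q m.
transitivity (\sum_s section_weight s *
               expected_payoff u (g k) (fun i => r i (s i))); last first.
  rewrite (expected_payoff_mix _ _ _ fiber_weight_sum); congr expected_payoff.
  apply/funext => i; rewrite /update /r; case: ifP => // _.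
  by rewrite -mulr_suml fiber_weight_sum mul1r.
rewrite {1}/expected_payoff /population_payoff.
under eq_bigr do rewrite mulr_sumr.
rewrite exchange_big; apply: eq_bigr => s _ /=.
have [->|/section_weight_section sK] := eqVneq (section_weight s) 0.
  by rewrite mul0r big1 // => b _; rewrite mul0r mulr0.
under eq_bigr do rewrite mulrCA.
rewrite -mulr_sumr; congr (_ * _).
(* Letting [k] represent its own group again gives a section of [g]. *)
pose tau i := if i == g k then k else s i.
have tauK : cancel tau g.
  by move=> i; rewrite /tau; case: eqP => [->|_] //; exact: sK.
rewrite (_ : (fun i => r i (s i)) = q \o tau).
  rewrite -(expected_payoff_section _ _ _ tauK); apply: eq_bigr => b _.
  congr (_ * u _ _); apply/ffunP => i; rewrite !ffunE /tau.
  by case: ifP.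
by apply/funext => i; rewrite /r /tau /=; case: ifP.
Qed.

(* The regrets of the members of a group, averaged over the group, give the
   regret of the player they stand for. *)
Lemma approx_nash_fiber_average (u : payoffs R n) (v : payoffs R M) (d e : R) p :
  (forall k b, `|v k b - population_payoff u k b| <= d) ->
  approx_nash v e p -> approx_nash u (e + 2 * d) (fiber_average p).
Proof.
move=> uv [pmix nash]; split; first exact: fiber_average_mixed.
move=> i; set P := fiber_average p.
(* Passing between [v] and the population game costs [d] twice, once at the deviation and once at
   [p]. *)
have key j k : g k = i ->
    expected_payoff u i (deviate P i j)
      - expected_payoff u i (update P i (p k)) <= e + 2 * d.
  move=> gki.
  have dmix : is_mixed (deviate p k j).
    move=> m; rewrite /deviate; case: eqP => // _.
    by case: j => -[|[|//]] /= _; rewrite ?lexx ler01.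
  have := expected_payoff_close dmix (uv k).
  have := expected_payoff_close pmix (uv k).
  rewrite !expected_population_payoff gki.
  (* A deviation of [k] alters the average of group [i] only, and [update] overwrites that entry. *)
  have -> : update (fiber_average (deviate p k j)) i (deviate p k j k)
          = deviate P i j.
    apply/funext => i'; rewrite /update /deviate eqxx; case: eqP => // /eqP ne.
    apply: eq_bigr => m _; rewrite /fiber_weight.
    have [gm|] := eqVneq (g m) i'; last by rewrite !mul0r.
    by case: eqP => // mk; rewrite -gm mk gki eqxx in ne.
  have : expected_payoff v k (deviate p k j) - expected_payoff v k p <= e.
    apply: le_trans (nash k); rewrite lerD2r le_max.
    by case: j {dmix} => -[|[|//]] h; apply/orP; [left|right];
      rewrite le_eqVlt; apply/orP; left; apply/eqP;
      congr (expected_payoff _ _ (deviate _ _ _)); apply: val_inj.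
  rewrite -/P !ler_norml => ? /andP[? ?] /andP[? ?]; lra.
have avg : expected_payoff u i P =
    \sum_m fiber_weight i m * expected_payoff u i (update P i (p m)).
  rewrite -{1}(_ : update P i (P i) = P); last first.
    by apply/funext => k; rewrite /update; case: eqP => // ->.
  rewrite expected_payoff_update.
  under eq_bigr do rewrite expected_payoff_update mulrDr !mulrA.
  rewrite big_split /= -!mulr_suml; congr (_ * _ + _).
  under eq_bigr do rewrite mulrBr mulr1.
  by rewrite sumrB fiber_weight_sum.
have one j : expected_payoff u i (deviate P i j) - expected_payoff u i P
             <= e + 2 * d.
  (* As the weights sum to 1 and vanish outside the group, it suffices to apply [key] to each
     member. *)
  rewrite avg -[X in X - _]mul1r -[leRHS]mul1r.
  rewrite -[X in X * _ - _](fiber_weight_sum i).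
  rewrite -[X in _ <= X * _](fiber_weight_sum i) !mulr_suml.
  rewrite -sumrB; apply: ler_sum => m _; rewrite -mulrBr.
  have [gm|gm] := eqVneq (g m) i; last first.
    by rewrite /fiber_weight (negPf gm) !mul0r.
  by apply: ler_wpM2l (key _ _ gm); exact: fiber_weight_ge0.
by rewrite lerBlDr ge_max; apply/andP; split; rewrite -lerBlDr.
Qed.

End Population.

(** * Lipschitz bounds *)

Lemma ord2_neq_dist (R : realType) (x y : 'I_2) :
  x != y -> `|(x : nat)%:R - (y : nat)%:R| = 1 :> R.
Proof.
case: x => -[|[|//]] ?; case: y => -[|[|//]] ? //= _.
  by rewrite sub0r normrN1.
by rewrite subr0 normr1.
Qed.

Lemma ord2_dist_le1 (R : realType) (x y : 'I_2) :
  `|(x : nat)%:R - (y : nat)%:R| <= 1 :> R.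
Proof.
by have [->|/ord2_neq_dist->] := eqVneq x y; rewrite ?subrr ?normr0.
Qed.

(** A hybrid argument: the players switch from [a] to [a'] one at a time, those of index below [t]
    having switched in [h t], and the differences telescope. Player [i0] never moves. *)
Lemma payoff_dist_le (R : realType) n (f : profile n -> R) (lam : 'I_n -> R) i0
    (a a' : profile n) :
  (forall i, i != i0 -> forall a1 a2 : profile n,
     (forall k, k != i -> a1 k = a2 k) -> `|f a1 - f a2| <= lam i) ->
  a i0 = a' i0 ->
  `|f a - f a'|
    <= \sum_(i < n | i != i0) lam i * `|(a i : nat)%:R - (a' i : nat)%:R|.
Proof.
move=> flam aa'.
pose h t : profile n := [ffun k : 'I_n => if (k < t)%N then a' k else a k].
have -> : f a - f a' = \sum_(0 <= t < n) (f (h t) - f (h t.+1)).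
  have -> : \sum_(0 <= t < n) (f (h t) - f (h t.+1)) =
            - \sum_(0 <= t < n) (f (h t.+1) - f (h t)).
    by rewrite -sumrN; apply: eq_bigr => t _; rewrite opprB.
  rewrite telescope_sumr // opprB; congr (f _ - f _).
    by apply/ffunP => k; rewrite ffunE.
  by apply/ffunP => k; rewrite ffunE ltn_ord.
rewrite big_mkord [leRHS]big_mkcond.
apply: le_trans (ler_norm_sum _ _ _) _; apply: ler_sum => i _.
have [ai|ai] := eqVneq (a i) (a' i).
  have -> : h i.+1 = h i.
    apply/ffunP => k; rewrite !ffunE ltnS leq_eqVlt.
    by case: eqP => //= /val_inj ->; rewrite ltnn.
  by rewrite ai !subrr normr0 mulr0 if_same.
have ii0 : i != i0 by apply: contraNneq ai => ->; apply/eqP.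
rewrite ii0 ord2_neq_dist // mulr1; apply: flam => // k ki.
by rewrite !ffunE ltnS [(k <= i)%N]leq_eqVlt (negPf (ki : (k : nat) != i)).
Qed.

(** * The fallback game and the empirical game *)

Section Games.
Variables (R : realType) (n M : nat) (g : 'I_M -> 'I_n).
Hypothesis g_surj : forall i, (0 < #|[set m | g m == i]|)%N.
Variables (lam : 'I_n -> R) (u : payoffs R n).
Hypothesis lam_ge0 : forall i, 0 <= lam i.
Hypothesis u_lam : forall (i i' : 'I_n) (a1 a2 : profile n), i' != i ->
  (forall k, k != i -> a1 k = a2 k) -> `|u i' a1 - u i' a2| <= lam i.

Definition constant_payoff (v : payoffs R n) : payoffs R M :=
  fun k b => v (g k) [ffun=> b k].

Lemma constant_payoff_lipschitz (K : R) : is_game u -> 0 <= K ->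
  lipschitz_game K (constant_payoff u).
Proof.
move=> ug K0; split=> [k b|k b b' bb']; first exact: ug.
rewrite /constant_payoff bb' subrr normr0 mulr_ge0 // sumr_ge0 // => i _.
Qed.

(** For every section, the two payoffs are values of [u (g k)] at profiles that agree at [g k], so
    [payoff_dist_le] applies. *)
Lemma constant_payoff_close k b :
  `|constant_payoff u k b - population_payoff g u k b| <= \sum_i lam i.
Proof.
rewrite /population_payoff -[constant_payoff u k b]mul1r.
rewrite -[X in X * _ - _](section_weight_sum R g_surj) mulr_suml -sumrB.
apply: le_trans (ler_norm_sum _ _ _) _.
rewrite -[leRHS]mul1r -[X in _ <= X * _](section_weight_sum R g_surj) mulr_suml.
apply: ler_sum => s _; rewrite -mulrBr normrM ger0_norm ?section_weight_ge0 //.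
apply: ler_wpM2l; first exact: section_weight_ge0.
apply: le_trans (payoff_dist_le (lam := lam) (i0 := g k) _ _) _.
- by move=> i ik a1 a2; apply: u_lam; rewrite eq_sym.
- by rewrite !ffunE eqxx.
rewrite [leLHS]big_mkcond; apply: ler_sum => i _; case: ifP => // _.
by rewrite ler_piMr // ord2_dist_le1.
Qed.

Variable N : nat.

Definition empirical_mean (T : finType) (X : T -> R) (om : {ffun 'I_N -> T}) : R :=
  N%:R^-1 * \sum_s X (om s).

Definition empirical_payoff (v : payoffs R n)
    (om : {ffun 'I_N -> {ffun 'I_n -> 'I_M}}) : payoffs R M := fun k b =>
  empirical_mean (fun s => v (g k) (sampled_profile s b (g k) (b k))) om.

(** Real-valued, so that its empirical mean is the frequency with which [m] is drawn. *)
Definition represents (m : 'I_M) (s : {ffun 'I_n -> 'I_M}) : R := (s (g m) == m)%:R.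

Lemma empirical_payoff_game (v : payoffs R n) om : (0 < N)%N ->
  is_game v -> is_game (empirical_payoff v om).
Proof.
move=> N0 vg k b; rewrite /empirical_payoff /empirical_mean; apply/andP; split.
  rewrite mulr_ge0 ?invr_ge0 // sumr_ge0 // => s _.
  by case/andP: (vg (g k) (sampled_profile (om s) b (g k) (b k))).
rewrite mulrC ler_pdivrMr ?ltr0n // mul1r.
rewrite -[N in leRHS]card_ord -sumr_const; apply: ler_sum => s _.
by case/andP: (vg (g k) (sampled_profile (om s) b (g k) (b k))).
Qed.

(* The same samples serve all the profiles, so only the frequency with which
   each member represents its group matters. *)
Lemma empirical_payoff_lipschitz
    (om : {ffun 'I_N -> {ffun 'I_n -> 'I_M}}) (K : R) : (0 < N)%N -> is_game u ->
  (forall s, cancel (om s) g) ->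
  (forall m, lam (g m) * empirical_mean (represents m) om <= K) ->
  lipschitz_game K (empirical_payoff u om).
Proof.
move=> N0 ug omK freq; split; first exact: empirical_payoff_game.
move=> k b b' bb'; rewrite /empirical_payoff /empirical_mean -mulrBr -sumrB.
rewrite normrM ger0_norm ?invr_ge0 //.
pose d m : R := `|(b m : nat)%:R - (b' m : nat)%:R|.
(* The sum over players is bounded by one over members, in which each other group contributes
   through its drawn representative; exchanging the sums then exposes the frequencies. *)
apply: (@le_trans _ _ (N%:R^-1 * \sum_s
    \sum_(m < M | m != k) lam (g m) * represents m (om s) * d m)).
  rewrite ler_wpM2l ?invr_ge0 //.
  apply: le_trans (ler_norm_sum _ _ _) _; apply: ler_sum => s _.
  apply: le_trans (payoff_dist_le (lam := lam) (i0 := g k) _ _) _.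
  - by move=> i ik a1 a2; apply: u_lam; rewrite eq_sym.
  - by rewrite !ffunE eqxx.
  rewrite [leLHS]big_mkcond (partition_big g xpredT) //=; apply: ler_sum => i _.
  have F0 m : 0 <= lam (g m) * represents m (om s) * d m.
    by rewrite /represents /d !mulr_ge0 ?ler0n ?normr_ge0.
  case: ifP => [ik|_]; last exact: sumr_ge0.
  rewrite (bigD1 (om s i)) /=; last first.
    rewrite omK eqxx andbT; apply: contraTneq ik => <-.
    by rewrite omK eqxx.
  rewrite /represents omK eqxx mulr1 /d !ffunE (negPf ik) lerDl.
  by apply: sumr_ge0 => m _; rewrite -/(represents m (om s)) -/(d m).
rewrite exchange_big mulr_sumr mulr_sumr; apply: ler_sum => m _ /=.
rewrite -mulr_suml -mulr_sumr mulrA ler_wpM2r ?normr_ge0 //.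
by rewrite mulrCA; exact: freq.
Qed.

End Games.

(** * Concentration of empirical means *)

Section Concentration.
Variables (R : realType) (T : finType) (w : T -> R) (N : nat).
Hypothesis w_ge0 : forall x, 0 <= w x.
Hypothesis w_sum : \sum_x w x = 1.

Definition mean (X : T -> R) : R := \sum_x w x * X x.

Definition sample_weight (om : {ffun 'I_N -> T}) : R := \prod_(s < N) w (om s).

Lemma sample_weight_ge0 om : 0 <= sample_weight om.
Proof. exact: prodr_ge0. Qed.

Lemma sample_weight_sum : \sum_om sample_weight om = 1.
Proof. by rewrite -(bigA_distr_bigA (fun _ => w)) big1. Qed.

(** From [1 - y <= expR (- y)] follows [(1 - y) * expR y <= 1], while
    [(1 - y) * (1 + y + 2 * y ^+ 2)] equals [1 + y ^+ 2 * (1 - 2 * y)]. *)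
Lemma expR_le_quadratic (y : R) : `|y| <= 1 / 2 -> expR y <= 1 + y + 2 * y ^+ 2.
Proof.
rewrite ler_norml => /andP[y1 y2].
have e0 : 0 < 1 - y by lra.
have := expR_ge1Dx (- y); rewrite expRN => ey.
have ey' : (1 - y) * expR y <= 1.
  by rewrite -ler_pdivlMr ?expR_gt0 // div1r.
rewrite -(ler_pM2l e0); apply: le_trans ey' _.
have y20 : 0 <= y ^+ 2 * (1 - 2 * y) by rewrite mulr_ge0 ?sqr_ge0 //; lra.
rewrite -subr_ge0; apply: le_trans y20 _; rewrite le_eqVlt; apply/orP; left.
by apply/eqP; ring.
Qed.

Lemma mean_itv X : (forall x, 0 <= X x <= 1) -> 0 <= mean X <= 1.
Proof.
move=> X01; rewrite sumr_ge0 => [|x _]; last first.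
  by rewrite mulr_ge0 //; case/andP: (X01 x).
rewrite -[leRHS]w_sum ler_sum // => x _.
by rewrite ler_piMr //; case/andP: (X01 x).
Qed.

(** Chernoff's method: the exponential moment factors over the samples, and each factor is at most
    [expR (- (t * d) + 2 * t ^+ 2)]. *)
Lemma upper_tail X (d : R) : (0 < N)%N -> (forall x, 0 <= X x <= 1) ->
  0 < d <= 2 ->
  \sum_(om | d < empirical_mean X om - mean X) sample_weight om
    <= expR (- (N%:R * d ^+ 2 / 8)).
Proof.
(* This [t] minimises the exponent, with value [- (d ^+ 2 / 8)]; [d <= 2] gives [t <= 1 / 2], as the
   quadratic bound requires. *)
move=> N0 X01 /andP[d0 d2]; set mu := mean X; pose t := d / 4.
have t0 : 0 <= t by rewrite /t; lra.
(* On the tail event the exponent is nonnegative, so the exponential dominates the indicator. *)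
apply: (@le_trans _ _ (\sum_om sample_weight om *
                         expR (\sum_s t * (X (om s) - mu - d)))).
  rewrite [leLHS]big_mkcond; apply: ler_sum => om _; case: ifP => [dev|_].
    rewrite ler_peMr ?sample_weight_ge0 // -[leLHS]expR0 ler_expR -mulr_sumr.
    rewrite mulr_ge0 // !sumrB !sumr_const card_ord.
    rewrite -[mu *+ N]mulr_natl -[d *+ N]mulr_natl.
    move: dev; rewrite /empirical_mean ltrBrDr -(ltr_pM2l (_ : 0 < N%:R :> R)) ?ltr0n //.
    by rewrite mulrA mulfV ?pnatr_eq0 -?lt0n // mul1r => h; lra.
  by rewrite mulr_ge0 ?sample_weight_ge0 ?expR_ge0.
rewrite /sample_weight.
under eq_bigr do rewrite expR_sum -big_split.
rewrite -(bigA_distr_bigA (fun _ x => w x * expR (t * (X x - mu - d)))) /=.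
rewrite prodr_const card_ord.
have -> : - (N%:R * d ^+ 2 / 8) = (- (d ^+ 2 / 8)) * N%:R by ring.
rewrite expRM_natr lerXn2r // ?nnegrE ?expR_ge0 //.
  by apply: sumr_ge0 => x _; rewrite mulr_ge0 ?expR_ge0.
have := mean_itv X01; rewrite -/mu => /andP[mu0 mu1].
apply: (@le_trans _ _ (\sum_x w x * (expR (- (t * d)) *
                              (1 + t * (X x - mu) + 2 * t ^+ 2)))).
  apply: ler_sum => x _; rewrite ler_wpM2l //.
  rewrite mulrBr expRD mulrC ler_wpM2l ?expR_ge0 //.
  have /andP[X0 X1] := X01 x.
  have tx : `|t * (X x - mu)| <= t.
    by rewrite normrM ger0_norm // ler_piMr // ler_norml; apply/andP; split; lra.
  apply: le_trans (expR_le_quadratic _) _; first by apply: le_trans tx _; rewrite /t; lra.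
  rewrite lerD2l ler_wpM2l // -real_normK ?num_real // lerXn2r // nnegrE //.
under eq_bigr do rewrite mulrCA.
rewrite -mulr_sumr.
have -> : \sum_x w x * (1 + t * (X x - mu) + 2 * t ^+ 2) = 1 + 2 * t ^+ 2.
  transitivity (\sum_x (w x * (1 - t * mu + 2 * t ^+ 2) + t * (w x * X x))).
    by apply: eq_bigr => x _; ring.
  rewrite big_split /= -mulr_suml w_sum -mulr_sumr -/(mean X) -/mu; ring.
apply: (@le_trans _ _ (expR (- (t * d)) * expR (2 * t ^+ 2))).
  by rewrite ler_wpM2l ?expR_ge0 // expR_ge1Dx.
by rewrite -expRD ler_expR /t le_eqVlt; apply/orP; left; apply/eqP; field.
Qed.

(** The lower tail of [X] is the upper tail of [1 - X]. *)
Lemma two_sided_tail X (d : R) : (0 < N)%N -> (forall x, 0 <= X x <= 1) ->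
  0 < d <= 2 ->
  \sum_(om | d < `|empirical_mean X om - mean X|) sample_weight om
    <= 2 * expR (- (N%:R * d ^+ 2 / 8)).
Proof.
move=> N0 X01 dd.
have Y01 x : 0 <= 1 - X x <= 1 by have := X01 x; lra.
have upX := upper_tail N0 X01 dd; have upY := upper_tail N0 Y01 dd.
rewrite mulr2n mulrDl !mul1r; apply: le_trans (lerD upX upY).
rewrite [leLHS]big_mkcond [X in _ <= X + _]big_mkcond [X in _ <= _ + X]big_mkcond.
rewrite -big_split.
apply: ler_sum => om _ /=.
have -> : empirical_mean (fun x => 1 - X x) om - mean (fun x => 1 - X x)
        = - (empirical_mean X om - mean X).
  have -> : mean (fun x => 1 - X x) = 1 - mean X.
    by rewrite /mean; under eq_bigr do rewrite mulrBr mulr1; rewrite sumrB w_sum.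
  rewrite /empirical_mean sumrB sumr_const card_ord mulrBr mulVf; first by ring.
  by rewrite pnatr_eq0 -lt0n.
have om0 := sample_weight_ge0 om.
rewrite ltNge ler_norml negb_and -!ltNge [_ < - d]ltrNr.
by case: (d < - _); case: (d < _); rewrite /= ?addr0 ?add0r // lerDl.
Qed.

Lemma union_tail (F : finType) (X : F -> T -> R) (d : R) : (0 < N)%N ->
  (forall f x, 0 <= X f x <= 1) -> 0 < d <= 2 ->
  1 - #|F|%:R * (2 * expR (- (N%:R * d ^+ 2 / 8)))
   <= \sum_(om | [forall f, `|empirical_mean (X f) om - mean (X f)| <= d])
         sample_weight om.
Proof.
move=> N0 X01 dd; rewrite lerBlDr -[leLHS]sample_weight_sum.
rewrite [leLHS](bigID (fun om =>
  [forall f, `|empirical_mean (X f) om - mean (X f)| <= d])) /=.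
rewrite lerD2l.
apply: (@le_trans _ _ (\sum_f \sum_(om | d < `|empirical_mean (X f) om - mean (X f)|)
                          sample_weight om)).
  under [in leRHS]eq_bigr do rewrite big_mkcond.
  rewrite exchange_big [leLHS]big_mkcond /=; apply: ler_sum => om _.
  have om0 := sample_weight_ge0 om.
  have rest0 (P : pred F) : 0 <= \sum_(f | P f)
      (if d < `|empirical_mean (X f) om - mean (X f)| then sample_weight om else 0).
    by apply: sumr_ge0 => f _; case: ifP.
  case: ifP => [/forallPn[f]|_]; last exact: rest0.
  by rewrite -ltNge => df; rewrite (bigD1 f) //= df lerDl; exact: rest0.
rewrite mulr_natl -sumr_const; apply: ler_sum => f _.
exact: two_sided_tail.
Qed.

End Concentration.

(** * Simulation by randomized algorithms *)

Section Simulation.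
Variables (R : realType) (n M : nat).
Variables (qs : profile M -> seq (profile n)) (G : payoffs R n -> payoffs R M).
Variable post : strategies R M -> strategies R n.
Hypothesis G_local : forall (u v : payoffs R n) b,
  (forall i a, a \in qs b -> u i a = v i a) -> forall k, G u k b = G v k b.

(* [v] collects the answers; it is meaningful only on the profiles queried. *)
Fixpoint ask (s : seq (profile n)) (v : payoffs R n)
    (next : payoffs R n -> query_tree R n) : query_tree R n :=
  match s with
  | [::] => next v
  | a :: s' => Query a (fun r =>
      ask s' (fun i a' => if a' == a then r i else v i a') next)
  end.

Lemma askP s v next u : exists2 v' : payoffs R n,
  forall i a, a \in s -> v' i a = u i a &
  output (ask s v next) u = output (next v') u /\
  num_queries (ask s v next) u = (size s + num_queries (next v') u)%N.
Proof.
(* Strengthened for the induction: answers that [v] already has right must survive the later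
   queries. *)
suff [v' v'E outE] : exists2 v' : payoffs R n,
  forall i a, a \in s \/ v i a = u i a -> v' i a = u i a &
  output (ask s v next) u = output (next v') u /\
  num_queries (ask s v next) u = (size s + num_queries (next v') u)%N.
  by exists v' => // i a sa; apply: v'E; left.
elim: s v => [|a s IH] v /=; first by exists v => // i a [].
have [v' v'E [-> ->]] := IH (fun i a' => if a' == a then u i a else v i a').
exists v' => // i a' h; apply: v'E.
have [->|ne] := eqVneq a' a; first by right.
by case: h => [|h]; [rewrite inE (negPf ne) /= => h; left|right].
Qed.

(** The record of answers starts at the default 0; by [G_local] the answer computed for [b] does not
    see the profiles outside [qs b]. *)
Fixpoint simulate (t : query_tree R M) : query_tree R n :=
  match t with
  | Output p => Output (post p)
  | Query b next =>
      ask (qs b) (fun _ _ => 0) (fun v => simulate (next (fun k => G v k b)))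
  end.

Lemma output_simulate t u : output (simulate t) u = post (output t (G u)).
Proof.
elim: t => [p|b next IH] //=.
have [v vu [-> _]] := askP (qs b) (fun _ _ => 0)
  (fun v => simulate (next (fun k => G v k b))) u.
rewrite IH; congr (post (output (next _) _)).
by apply/funext => k; apply: G_local.
Qed.

Lemma num_queries_simulate K t u : (forall b, size (qs b) = K) ->
  num_queries (simulate t) u = (K * num_queries t (G u))%N.
Proof.
move=> qsK; elim: t => [p|b next IH] /=; first by rewrite muln0.
have [v vu [_ ->]] := askP (qs b) (fun _ _ => 0)
  (fun v => simulate (next (fun k => G v k b))) u.
rewrite IH qsK mulnS; congr (_ + _ * num_queries (next _) _)%N.
by apply/funext => k; apply: G_local.
Qed.

End Simulation.

(** * Finite mixtures of copies of a probability space *)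

Section NatProduct.
Context d (T : measurableType d) (R : realType).
Local Open Scope classical_set_scope.

(** A preimage is the countable union of its slices, each a measurable rectangle. *)
Lemma measurable_nat_prod d' (U : measurableType d') (f : nat * T -> U) :
  (forall k, measurable_fun setT (fun w => f (k, w))) -> measurable_fun setT f.
Proof.
move=> mf _ Y mY; rewrite setTI.
have -> : f @^-1` Y = \bigcup_k ([set k] `*` ((fun w => f (k, w)) @^-1` Y)).
  apply/seteqP; split=> [[k w] fY|[k w] [k' _ [/= -> fY]] //].
  by exists k.
apply: bigcupT_measurable => k; apply: measurableX => //.
by have := mf k measurableT Y mY; rewrite setTI.
Qed.

Variables (P : probability T R) (c : nat -> {nonneg R}) (m : nat).
Hypothesis c_sum : \sum_(k < m) (c k)%:num = 1.

(** The copy of [P] carried by the slice of first coordinate [k]. *)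
Definition section_measure (k : nat) : {measure set (nat * T) -> \bar R}.
Proof. refine (pushforward P (pair k)); exact: pair1_measurable. Defined.

Definition nat_mixture : set (nat * T) -> \bar R :=
  msum (fun k => mscale (c k) (section_measure k)) m.

HB.instance Definition _ := Measure.on nat_mixture.

Lemma nat_mixtureE (X : set (nat * T)) :
  nat_mixture X = (\sum_(k < m) (c k)%:num%:E * P [set w | X (k : nat, w)])%E.
Proof. by []. Qed.

Let nat_mixture_setT : nat_mixture setT = 1%E.
Proof.
rewrite nat_mixtureE -[in RHS]c_sum -sumEFin; apply: eq_bigr => k _.
rewrite (_ : [set w | _] = setT); last by apply/seteqP; split.
by rewrite probability_setT mule1.
Qed.

HB.instance Definition _ :=
  Measure_isProbability.Build _ _ _ nat_mixture nat_mixture_setT.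

Definition nat_mixture_prob : probability (nat * T)%type R := nat_mixture.

End NatProduct.

(** The event is a finite intersection of inequalities between polynomials in the measurable
    coordinates of [p]. *)
Lemma measurable_approx_nash (R : realType) d (T : measurableType d) n
    (u : payoffs R n) (e : R) (p : T -> strategies R n) :
  (forall i, measurable_fun setT (fun w => p w i)) ->
  measurable [set w | approx_nash u e (p w)]%classic.
Proof.
move=> mp.
have mEP i (q : T -> strategies R n) : (forall k, measurable_fun setT (fun w => q w k)) ->
    measurable_fun setT (fun w => expected_payoff u i (q w)).
  move=> mq; apply: measurable_sum => a; apply: measurable_funM => //.
  apply: measurable_prod => k _; rewrite /prob_action; case: (a k == ord0) => //.
  by apply: measurable_funB.
have mle (f h : T -> R) : measurable_fun setT f -> measurable_fun setT h ->
    measurable [set w | f w <= h w]%classic.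
  by move=> mf mh; rewrite -[X in measurable X]setTI; apply: measurable_fun_le.
pose Q i := ([set w | 0 <= p w i] `&` [set w | p w i <= 1] `&`
  [set w | expected_payoff u i (deviate (p w) i ord0)
             <= e + expected_payoff u i (p w)] `&`
  [set w | expected_payoff u i (deviate (p w) i ord_max)
             <= e + expected_payoff u i (p w)])%classic.
have -> : [set w | approx_nash u e (p w)]%classic = (\bigcap_(i in setT) Q i)%classic.
  apply/seteqP; split=> [w [pm nash] i _|w Qw].
    have := nash i; rewrite lerBlDr ge_max => /andP[? ?].
    by have /andP[? ?] := pm i; split=> //; split=> //; split.
  split=> i; first by have [[[/= -> ->]]] := Qw i I.
  by rewrite lerBlDr ge_max; have [[_ /= ->]] := Qw i I.
apply: fin_bigcap_measurable => [|i _]; first exact: finite_finset.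
have mdev j : measurable_fun setT (fun w => expected_payoff u i (deviate (p w) i j)).
  by apply: mEP => k; rewrite /deviate; case: (k == i).
by rewrite /Q; do !apply: measurableI; apply: mle => //;
  do ?apply: measurable_funD => //; apply: mEP.
Qed.

(* [B] draws a seed [s], runs [A] on the game [G s u], answering its queries
   through [qs s], and averages the output over the groups. *)
Lemma seeded_simulation (R : realType) n M (A : rand_algorithm R M)
    (g : 'I_M -> 'I_n) (S : finType) (wt : S -> R)
    (qs : S -> profile M -> seq (profile n))
    (G : S -> payoffs R n -> payoffs R M) (K : S -> nat) :
  (forall s, 0 <= wt s) -> \sum_s wt s = 1 ->
  (forall s (u v : payoffs R n) b,
     (forall i a, a \in qs s b -> u i a = v i a) ->
     forall k, G s u k b = G s v k b) ->
  (forall s u, is_game u -> is_game (G s u)) ->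
  (forall s b, size (qs s b) = K s) ->
  exists B : rand_algorithm R n,
  forall u, is_game u ->
  (forall q Kmax,
     (forall s (w : ra_space A), (num_queries (ra_tree w) (G s u) <= q)%N) ->
     (forall s, (K s <= Kmax)%N) ->
     forall w : ra_space B, (num_queries (ra_tree w) u <= q * Kmax)%N) /\
  (forall (good : pred S) (e e' eta eta' : R),
     (forall s, good s ->
        ((1 - eta)%:E <= ra_prob A
           [set w : ra_space A |
              approx_nash (G s u) e (output (ra_tree w) (G s u))]%classic)%E) ->
     (forall s p, good s -> approx_nash (G s u) e p ->
        approx_nash u e' (fiber_average g p)) ->
     1 - eta' <= \sum_(s | good s) wt s -> 0 <= eta <= 1 -> 0 <= eta' ->
     ((1 - (eta + eta'))%:E <=
        ra_prob B [set w : ra_space B |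
                     approx_nash u e' (output (ra_tree w) u)]%classic)%E).
Proof.
move=> wt0 wt1 Gloc Ggame qsK.
have S0 : (0 < #|S|)%N.
  rewrite lt0n; apply: contra_eqN wt1 => /eqP/card0_eq S0.
  by rewrite big1 ?(eq_sym 0) ?oner_eq0 // => s; have := S0 s; rewrite !inE.
(* Seeds are coded by natural numbers; [s0] decodes the indices from [#|S|] on, which the mixture
   never draws. *)
pose s0 : S := enum_val (Ordinal S0).
pose dec k : S := nth s0 (enum S) k.
pose c k := NngNum (wt0 (dec k)).
have reind (F : S -> \bar R) : (\sum_(k < #|S|) F (dec k) = \sum_s F s)%E.
  rewrite -[RHS]big_enum /= (big_nth s0) big_mkord cardT; exact: eq_bigr.
have c1 : \sum_(k < #|S|) (c k)%:num = 1.
  apply: EFin_inj; rewrite -sumEFin (reind (fun s => (wt s)%:E)) sumEFin.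
  by rewrite wt1.
pose tree (kw : nat * ra_space A) : query_tree R n :=
  simulate (qs (dec kw.1)) (G (dec kw.1)) (fiber_average g) (ra_tree kw.2).
have outE kw u : output (tree kw) u =
    fiber_average g (output (ra_tree kw.2) (G (dec kw.1) u)).
  exact: output_simulate (Gloc _) _ _.
have numE kw u : num_queries (tree kw) u =
    (K (dec kw.1) * num_queries (ra_tree kw.2) (G (dec kw.1) u))%N.
  by apply: num_queries_simulate; [exact: Gloc|exact: qsK].
have mout (u : payoffs R n) : is_game u -> forall i,
    measurable_fun setT (fun kw => output (tree kw) u i).
  move=> ug i; apply: measurable_nat_prod => k.
  under eq_fun do rewrite outE.
  apply: measurable_sum => m; apply: measurable_funM => //.
  exact: ra_output_measurable (Ggame _ _ ug) m.
have mnum (u : payoffs R n) : is_game u ->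
    measurable_fun setT (fun kw => num_queries (tree kw) u).
  move=> ug; apply: measurable_nat_prod => k.
  under eq_fun do rewrite numE.
  apply: (measurableT_comp (f := muln (K (dec k)))) => //.
  exact: ra_queries_measurable (Ggame _ _ ug).
exists (@RandAlgorithm R n _ _ (nat_mixture_prob (ra_prob A) c1) tree mout mnum).
move=> u ug; split=> /= [q Kmax qA Kle kw|good e e' eta eta' nashA recov wgood eta01 eta'0].
  by rewrite numE mulnC leq_mul.
rewrite /nat_mixture_prob /= nat_mixtureE.
pose X s := [set w : ra_space A |
  approx_nash u e' (fiber_average g (output (ra_tree w) (G s u)))]%classic.
rewrite (eq_bigr (fun k : 'I_#|S| => (wt (dec k))%:E * ra_prob A (X (dec k))))%E; last first.
  by move=> k _; congr (_ * ra_prob A _)%E; apply/funext => w /=; rewrite outE.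
rewrite (reind (fun s => (wt s)%:E * ra_prob A (X s)))%E.
apply: (@le_trans _ _ (\sum_(s | good s) (wt s * (1 - eta))%:E)%E).
  rewrite sumEFin lee_fin -mulr_suml.
  case/andP: eta01 => eta0 eta1.
  (* The product exceeds [1 - (eta + eta')] by [eta' * eta]. *)
  apply: (@le_trans _ _ ((1 - eta') * (1 - eta))).
    by rewrite -subr_ge0 (_ : _ - _ = eta' * eta) ?mulr_ge0 //; ring.
  by rewrite ler_wpM2r // subr_ge0.
rewrite [leLHS]big_mkcond; apply: lee_sum => s _; case: ifP => [gs|_]; last first.
  by rewrite mule_ge0 ?lee_fin.
rewrite EFinM; apply: lee_wpmul2l; first by rewrite lee_fin.
apply: le_trans (nashA s gs) _; apply: le_measure; rewrite ?inE.
- by apply: measurable_approx_nash => i; exact: ra_output_measurable (Ggame _ _ ug) i.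
- apply: measurable_approx_nash => i; apply: measurable_sum => m.
  apply: measurable_funM => //.
  exact: ra_output_measurable (Ggame _ _ ug) m.
- by move=> w /=; exact: recov.
Qed.

(** * The reduction *)

(** The disjoint union of blocks of sizes [l i] embeds into ['I_M], and [g] reads off the block. *)
Lemma exists_map_fibers n M (l : 'I_n -> nat) : (0 < n)%N ->
  (\sum_i l i <= M)%N ->
  exists g : 'I_M -> 'I_n, forall i, (l i <= #|[set m | g m == i]|)%N.
Proof.
move=> n0 lM; pose T : finType := {i : 'I_n & 'I_(l i)}.
have TM : (#|T| <= M)%N.
  rewrite card_tagged sumnE big_map big_enum /=.
  by under eq_bigr do rewrite card_ord.
pose f (x : T) : 'I_M := widen_ord TM (enum_rank x).
have f_inj : injective f.
  by move=> x y /(congr1 val) /= /val_inj/enum_rank_inj.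
(* Members outside all blocks join the first group, which only enlarges it. *)
pose g m := if [pick x | f x == m] is Some x then tag x else Ordinal n0.
have gf x : g (f x) = tag x.
  rewrite /g; case: pickP => [y /eqP/f_inj -> //|/(_ x)].
  by rewrite eqxx.
exists g => i; rewrite -{1}(card_ord (l i)).
rewrite -(card_imset predT (f := fun j : 'I_(l i) => f (Tagged _ j))).
  apply: subset_leq_card; apply/fintype.subsetP => m /imsetP[j _ ->].
  by rewrite inE gf.
move=> j k /f_inj/eqP; rewrite -tag_eqE /tag_eq eqxx /= tagged_asE.
by move/eqP.
Qed.

(* Group sizes [floor (n lam_i / Lambda) + 1], which add up to at most [2 n]. *)
Lemma exists_groups (R : realType) n (lam : 'I_n -> R) (Lambda : R) :
  (0 < n)%N -> (forall i, 0 <= lam i) -> \sum_i lam i = Lambda ->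
  exists g : 'I_(2 * n) -> 'I_n, forall i,
    (0 < #|[set m | g m == i]|)%N /\
    n%:R * lam i <= Lambda * #|[set m | g m == i]|%:R.
Proof.
move=> n0 lam0 lamE.
have L0 : 0 <= Lambda by rewrite -lamE sumr_ge0.
(* For [Lambda = 0] this quotient is 0 by convention, and one member per group is requested. *)
pose x i := n%:R * lam i / Lambda.
have x0 i : 0 <= x i by rewrite !mulr_ge0 ?invr_ge0.
have [|g gl] := exists_map_fibers (l := fun i => (Num.trunc (x i)).+1) (M := (2 * n)%N) n0.
  rewrite -(ler_nat R) natr_sum.
  apply: (@le_trans _ _ (\sum_i (x i + 1))).
    by apply: ler_sum => i _; rewrite -natr1 lerD2r truncn_le.
  rewrite big_split /= sumr_const card_ord -mulr_suml -mulr_sumr lamE natrM.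
  have n0R : 0 <= n%:R :> R by [].
  have [->|LN0] := eqVneq Lambda 0; first by rewrite mulr0 mul0r; lra.
  by rewrite mulfK //; lra.
exists g => i; split; first exact: leq_trans (gl i).
have [L00|LN0] := eqVneq Lambda 0.
  suff -> : lam i = 0 by rewrite mulr0 mulr_ge0.
  apply/eqP; rewrite eq_le lam0 andbT -L00 -lamE (bigD1 i) //= lerDl.
  by rewrite sumr_ge0.
rewrite -ler_pdivrMl ?lt_def ?LN0 // mulrC -/(x i).
apply: le_trans (ltW (truncnS_gt (x i))) _.
by rewrite ler_nat.
Qed.

(** The representatives are independent, so the factors of all groups but that of [m] sum to 1. *)
Lemma mean_represents (R : realType) n M (g : 'I_M -> 'I_n) :
  (forall i, (0 < #|[set m | g m == i]|)%N) -> forall m,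
  mean (section_weight R g) (represents R g m) = fiber_weight R g (g m) m.
Proof.
move=> g_surj m; rewrite /mean.
pose F i x : R := fiber_weight R g i x * (if i == g m then (x == m)%:R else 1).
transitivity (\sum_(s : {ffun 'I_n -> 'I_M}) \prod_i F i (s i)).
  apply: eq_bigr => s _; rewrite big_split /=; congr (_ * _).
  by rewrite -big_mkcond big_pred1_eq.
rewrite -(bigA_distr_bigA F) (bigD1 (g m)) //= [X in _ * X]big1 => [|i im]; last first.
  rewrite -(fiber_weight_sum R g_surj i); apply: eq_bigr => x _.
  by rewrite /F (negPf im) mulr1.
rewrite mulr1 (bigD1 m) //= big1 => [|x xm]; rewrite /F eqxx.
  by rewrite eqxx mulr1 addr0.
by rewrite (negPf xm) mulr0.
Qed.

Definition constant_queries n : seq (profile n) := [seq [ffun=> j] | j <- enum 'I_2].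

Lemma constant_payoff_local (R : realType) n M (g : 'I_M -> 'I_n)
    (u v : payoffs R n) b :
  (forall i a, a \in constant_queries n -> u i a = v i a) ->
  forall k, constant_payoff g u k b = constant_payoff g v k b.
Proof. by move=> uv k; apply: uv; apply: map_f; rewrite mem_enum. Qed.

Lemma approx_nash_le (R : realType) n (u : payoffs R n) (e e' : R) p :
  e <= e' -> approx_nash u e p -> approx_nash u e' p.
Proof. by move=> ee [pm nash]; split=> // i; apply: le_trans ee. Qed.

(* The constant makes [N] samples with deviation [eps / (8 n)] fail with
   probability at most [2 expR (- (7 n + ln (1 / eta)))] each. *)
Definition sample_bound (R : realType) (x y z : R) : R :=
  512 * x ^+ 2 * y ^+ 2 * (7 * x + z).

Section Reduction.
Variables (R : realType) (n : nat) (Lambda eps eta : R) (lam : 'I_n -> R).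
Variable A : rand_algorithm R (2 * n).
Hypothesis n_gt0 : (0 < n)%N.
Hypothesis eps_gt0 : 0 < eps.
Hypothesis eta_itv : 0 < eta < 1.
Hypothesis lam_ge0 : forall i, 0 <= lam i.
Hypothesis lam_sum : \sum_i lam i = Lambda.

Let kappa : R := 3 * Lambda / (2 * n)%:R.

Let Lambda_ge0 : 0 <= Lambda. Proof. by rewrite -lam_sum sumr_ge0. Qed.

Let kappa_ge0 : 0 <= kappa. Proof. by rewrite /kappa !mulr_ge0 ?invr_ge0. Qed.

(** The fallback game is within [Lambda] of the population game, so the regret is at most
    [eps / 2 + 2 * (eps / 4)]. The seed is trivial and each query costs two. *)
Lemma small_reduction : Lambda <= eps / 4 ->
  exists B : rand_algorithm R n, forall q : nat,
  computes_nash (lipschitz_game kappa) (eps / 2) (eta / 2) q%:R A ->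
  computes_nash (multi_lipschitz_game Lambda lam) eps eta (q * 2)%:R B.
Proof.
move=> Lsmall; have [g gP] := exists_groups n_gt0 lam_ge0 lam_sum.
have g_surj i := (gP i).1.
have [|||||B HB] := @seeded_simulation R n (2 * n) A g unit (fun=> 1)
  (fun _ _ => constant_queries n) (fun=> constant_payoff g) (fun=> 2%N).
- by [].
- by rewrite sumr_const card_unit.
- by move=> _ u v b; exact: constant_payoff_local.
- by move=> _ u ug k b; exact: ug.
- by move=> _ _; rewrite size_map size_enum_ord.
exists B => q qA u [ug _ _ _ u_lam].
have uLip := constant_payoff_lipschitz g ug kappa_ge0.
have /andP[eta0 eta1] := eta_itv.
have [qu pu] := qA _ uLip; have [HBq HBp] := HB u ug; split.
  move=> w; rewrite ler_nat; apply: HBq => // _ w'.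
  by rewrite -(ler_nat R).
have := HBp predT (eps / 2) eps (eta / 2) (eta / 2) _ _ _ _ _.
rewrite -splitr; apply.
- by move=> _ _; exact: pu.
- move=> _ p _ /(approx_nash_fiber_average g_surj
    (fun k b => constant_payoff_close g_surj lam_ge0 u_lam k b)).
  by apply: approx_nash_le; rewrite lam_sum; lra.
- by rewrite (bigD1 tt) //= big1 ?addr0 => [|[] //]; lra.
- lra.
- lra.
Qed.

Let N := (Num.trunc (sample_bound n%:R (1 / eps) (ln (1 / eta)))).+1.
(** Small enough for both uses: at most [eps / 8] for the regret, and below [Lambda / (2 * n)] for
    the Lipschitz constant once [eps / 4 < Lambda]. *)
Let delta := eps / (8 * n%:R).

(** The left summand indexes the frequencies of the members, the right one the payoffs of all
    members at all profiles. *)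
Lemma failure_bound :
  (#|{: 'I_(2 * n) + profile (2 * n) * 'I_(2 * n)}|)%:R *
    (2 * expR (- (N%:R * delta ^+ 2 / 8))) <= eta / 2.
Proof.
have nR : 0 < n%:R :> R by rewrite ltr0n.
have /andP[eta0 eta1] := eta_itv.
have lnE : expR (- ln (1 / eta)) = eta.
  rewrite div1r lnV ?posrE ?opprK ?lnK ?posrE //; lra.
(* Since [512 = 8 * 8 ^ 2], the sample bound times [delta ^+ 2 / 8] is exactly
   [7 * n + ln (1 / eta)]. *)
have expN : expR (- (N%:R * delta ^+ 2 / 8)) <= expR (- (7 * n%:R)) * eta.
  rewrite -[X in _ <= _ * X]lnE -expRD ler_expR -opprD lerN2.
  set X := 7 * n%:R + _.
  have : sample_bound n%:R (1 / eps) (ln (1 / eta)) <= N%:R.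
    exact: ltW (truncnS_gt _).
  rewrite /sample_bound -/X.
  have c0 : 0 <= delta ^+ 2 / 8 by rewrite mulr_ge0 ?sqr_ge0.
  move=> /(ler_wpM2r c0) h; rewrite -[N%:R * _ / _]mulrA; apply: le_trans h.
  rewrite le_eqVlt; apply/orP; left; apply/eqP; rewrite /delta; field.
  by rewrite !gt_eqF.
have e2 : 2 <= expR 1 :> R by have := @expR_ge1Dx R 1; lra.
(* The left side is at most [16 * n * 2 ^ (2 * n)], hence at most [2 ^ (4 + 3 * n)], and
   [4 + 3 * n <= 7 * n]. The 4 combines the two tails with the target [eta / 2]. *)
have cardE : 4 * (#|{: 'I_(2 * n) + profile (2 * n) * 'I_(2 * n)}|)%:R
             <= expR (7 * n%:R) :> R.
  rewrite card_sum card_prod card_ffun !card_ord.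
  apply: (@le_trans _ _ (2 ^ (7 * n))%:R).
    rewrite -natrM ler_nat.
    have n2 : (n <= 2 ^ n)%N by rewrite ltnW // ltn_expl.
    have p1 : (1 <= 2 ^ (2 * n))%N by rewrite expn_gt0.
    apply: (@leq_trans (16 * (2 ^ n * 2 ^ (2 * n)))%N).
      have : (4 * (2 * n + 2 ^ (2 * n) * (2 * n)) <= 16 * (n * 2 ^ (2 * n)))%N.
        nia.
      by move=> /leq_trans; apply; rewrite leq_mul2l leq_mul2r n2 orbT.
    by rewrite (_ : 16 = 2 ^ 4)%N // -!expnD leq_exp2l //; lia.
  rewrite natrX (_ : 7 * n%:R = 1 * (7 * n)%:R :> R) ?expRM_natr ?natrM ?mul1r //.
  by rewrite lerXn2r ?nnegrE ?expR_ge0.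
apply: (@le_trans _ _ ((#|{: 'I_(2 * n) + profile (2 * n) * 'I_(2 * n)}|)%:R *
    (2 * (expR (- (7 * n%:R)) * eta)))).
  by rewrite ler_wpM2l // ler_wpM2l.
have e7 : 0 < expR (7 * n%:R) :> R by exact: expR_gt0.
rewrite expRN; set c := #|_|%:R in cardE *.
have -> : c * (2 * ((expR (7 * n%:R))^-1 * eta)) = (4 * c) / expR (7 * n%:R) * (eta / 2).
  by field; rewrite gt_eqF.
rewrite ler_piMl //; first by lra.
by rewrite ler_pdivrMr // mul1r.
Qed.

Let P := 2 * n%:R * (sample_bound n%:R (1 / eps) (ln (1 / eta)) + 1).

Lemma query_bound : (N * (2 * n))%:R <= P.
Proof.
have /andP[eta0 eta1] := eta_itv.
have L0 : 0 <= ln (1 / eta).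
  by apply: ln_ge0; rewrite div1r invf_ge1 // ltW.
have X0 : 0 <= sample_bound n%:R (1 / eps) (ln (1 / eta)).
  apply: mulr_ge0; first by do 2!(apply: mulr_ge0; last exact: sqr_ge0); exact: ler0n.
  by apply: addr_ge0 L0; apply: mulr_ge0; exact: ler0n.
rewrite natrM mulrC natrM /P; apply: ler_wpM2l; first by apply: mulr_ge0; exact: ler0n.
by rewrite /N -natr1 lerD2r truncn_le.
Qed.

Lemma large_reduction : eps / 4 < Lambda -> Lambda <= n%:R ->
  exists B : rand_algorithm R n, forall q : nat,
  computes_nash (lipschitz_game kappa) (eps / 2) (eta / 2) q%:R A ->
  computes_nash (multi_lipschitz_game Lambda lam) eps eta (q * (N * (2 * n)))%:R B.
Proof.
move=> Llarge Ln.
have nR : 0 < n%:R :> R by rewrite ltr0n.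
have [g gP] := exists_groups n_gt0 lam_ge0 lam_sum.
have g_surj i := (gP i).1.
pose seed := {ffun 'I_N -> {ffun 'I_n -> 'I_(2 * n)}}.
pose good_seed (om : seed) : bool := [forall s, forall i, g (om s i) == i] &&
  [forall m, lam (g m) * empirical_mean (represents R g m) om <= kappa].
(* The test on the seed does not look at the payoffs, and the game passed on to
   [A] always satisfies its Lipschitz hypothesis: its query bound holds for every seed. *)
pose G (om : seed) : payoffs R n -> payoffs R (2 * n) := fun u =>
  if good_seed om then empirical_payoff g u om else constant_payoff g u.
pose qs (om : seed) (b : profile (2 * n)) : seq (profile n) :=
  if good_seed om then
    [seq sampled_profile (om s) b (g k) (b k) | s <- enum 'I_N, k <- enum 'I_(2 * n)]
  else constant_queries n.
pose K (om : seed) := if good_seed om then (N * (2 * n))%N else 2%N.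
have [|||||B HB] := @seeded_simulation R n (2 * n) A g _
  (@sample_weight R _ (section_weight R g) N) qs G K.
- by apply: sample_weight_ge0; exact: section_weight_ge0.
- by apply: sample_weight_sum; exact: section_weight_sum.
- move=> om u v b; rewrite /qs /G; case: ifP => _ uv k; last first.
    exact: constant_payoff_local.
  rewrite /empirical_payoff /empirical_mean; congr (_ * _); apply: eq_bigr => s _.
  apply: uv; apply: (allpairs_f (fun s k => sampled_profile (om s) b (g k) (b k)));
    by rewrite mem_enum.
- move=> om u ug; rewrite /G; case: ifP => _; last by move=> k b; exact: ug.
  exact: empirical_payoff_game.
- move=> om b; rewrite /qs /K; case: ifP => _.
    by rewrite size_allpairs !size_enum_ord.
  by rewrite size_map size_enum_ord.
have /andP[eta0 eta1] := eta_itv.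
exists B => q qA u [ug lam1 _ _ u_lam].
have uLip om : lipschitz_game kappa (G om u).
  rewrite /G; case: ifP => [/andP[/forallP omK /forallP freq]|_].
    apply: (empirical_payoff_lipschitz lam_ge0 u_lam) => // s i.
    by apply/eqP; exact: (forallP (omK s)).
  exact: constant_payoff_lipschitz.
have [HBq HBp] := HB u ug; split.
  move=> w; rewrite ler_nat; apply: HBq => [om w'|om].
    by rewrite -(ler_nat R); exact: (qA _ (uLip om)).1.
  by rewrite /K; case: ifP => // _; rewrite mulnCA leq_pmulr // muln_gt0.
pose F : finType := ('I_(2 * n) + profile (2 * n) * 'I_(2 * n))%type.
pose X (f : F) (s : {ffun 'I_n -> 'I_(2 * n)}) : R :=
  match f with
  | inl m => represents R g m s
  | inr bk => u (g bk.2) (sampled_profile s bk.1 (g bk.2) (bk.1 bk.2))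
  end.
have X01 f s : 0 <= X f s <= 1.
  case: f => [m|[b k]] /=; last exact: ug.
  by rewrite /represents ler0n lern1 leq_b1.
pose close (om : seed) : bool :=
  [forall f, `|empirical_mean (X f) om - mean (section_weight R g) (X f)| <= delta].
have delta_gt0 : 0 < delta by rewrite /delta divr_gt0 // mulr_gt0.
have delta_le : delta <= Lambda / (2 * n%:R).
  rewrite /delta -(ler_pM2r (_ : 0 < 8 * n%:R)) ?mulr_gt0 // divfK ?gt_eqF ?mulr_gt0 //.
  have -> : Lambda / (2 * n%:R) * (8 * n%:R) = 4 * Lambda by field; rewrite gt_eqF.
  lra.
have delta_le2 : delta <= 2.
  apply: le_trans delta_le _; rewrite ler_pdivrMr ?mulr_gt0 //; lra.
have delta_eps : delta <= eps / 8.
  rewrite /delta ler_pdivrMr ?mulr_gt0 //.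
  have n1 : 1 <= n%:R :> R by rewrite ler1n.
  have -> : eps / 8 * (8 * n%:R) = eps * n%:R by field.
  by rewrite ler_peMr // ltW.
(* A seed of nonzero weight consists of sections. For a group of size [c], using [lam (g m) <= 1],
   the test value is at most [lam (g m) / c + delta], hence at most [Lambda / n + Lambda / (2 * n)],
   which is [kappa]. *)
have close_good om : sample_weight (section_weight R g) om != 0 -> close om ->
    good_seed om.
  move=> /prodf_neq0 om0 /forallP cl; apply/andP; split.
    apply/forallP => s; apply/forallP => i.
    by rewrite (section_weight_section (om0 s isT)).
  apply/forallP => m; have := cl (inl m); rewrite mean_represents //.
  rewrite /fiber_weight eqxx ler_norml => /andP[_ freq].
  set c := #|_| in freq.
  have c0 : 0 < c%:R :> R by rewrite ltr0n; exact: g_surj.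
  have lamc : lam (g m) / c%:R <= Lambda / n%:R.
    rewrite ler_pdivrMr // mulrAC ler_pdivlMr // mulrC.
    exact: (gP (g m)).2.
  apply: (@le_trans _ _ (lam (g m) * (c%:R^-1 + delta))).
    by rewrite ler_wpM2l // addrC -lerBlDr.
  rewrite mulrDr; apply: (@le_trans _ _ (Lambda / n%:R + Lambda / (2 * n%:R))).
    apply: lerD => //; apply: le_trans delta_le.
    by rewrite ler_piMl // ltW.
  rewrite /kappa natrM le_eqVlt; apply/orP; left; apply/eqP; field.
  by rewrite gt_eqF.
(* Requiring [good_seed] as well selects the estimated game and, by [close_good], loses no weight.
   The regret is then at most [eps / 2 + 2 * delta]. *)
have := HBp (fun om => close om && good_seed om) (eps / 2) eps (eta / 2) (eta / 2) _ _ _ _ _.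
rewrite -splitr; apply.
- by move=> om _; exact: (qA _ (uLip om)).2.
- move=> om p /andP[/forallP cl gom]; rewrite /G gom => nash.
  have cl' k b : `|empirical_payoff g u om k b - population_payoff g u k b| <= delta.
    exact: (cl (inr (b, k))).
  by apply: approx_nash_le (approx_nash_fiber_average g_surj cl' nash); lra.
- apply: le_trans (_ : _ <= 1 - #|F|%:R * (2 * expR (- (N%:R * delta ^+ 2 / 8)))) _.
    by rewrite lerD2l lerN2; exact: failure_bound.
  apply: le_trans (union_tail (section_weight_ge0 R g) _ _ X01 _) _ => //.
  + exact: section_weight_sum.
  + by rewrite delta_gt0.
  rewrite le_eqVlt; apply/orP; left; apply/eqP.
  rewrite [LHS](bigID good_seed) /= [X in _ + X]big1 ?addr0 // => om /andP[cl].
  by apply: contraNeq => /close_good; exact.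
- lra.
- lra.
Qed.

End Reduction.

Lemma computes_nash_le (R : realType) n (C : payoffs R n -> Prop)
    (eps eta q q' : R) (B : rand_algorithm R n) :
  q <= q' -> computes_nash C eps eta q B -> computes_nash C eps eta q' B.
Proof.
move=> qq BC u /BC[Bq Bp]; split=> // w; exact: le_trans (Bq w) qq.
Qed.

Lemma reduction_exists (R : realType) n (Lambda eps eta : R) lam
    (A : rand_algorithm R (2 * n)) :
  (0 < n)%N -> 0 <= Lambda -> 0 < eps -> 0 < eta < 1 ->
  exists B : rand_algorithm R n, forall q : nat,
    computes_nash (lipschitz_game (3 * Lambda / (2 * n)%:R))
      (eps / 2) (eta / 2) q%:R A ->
    computes_nash (multi_lipschitz_game Lambda lam) eps eta
      (q%:R * (2 * n%:R * (sample_bound n%:R (1 / eps) (ln (1 / eta)) + 1))) B.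
Proof.
move=> n0 L0 eps0 eta01.
(* If no game has the constants [lam], any algorithm will do; otherwise a witness game yields the
   bounds on [lam]. *)
have [[u [ug lam1 lamE _ u_lam]]|no] :=
    pselect (exists u, multi_lipschitz_game Lambda lam u); last first.
  have mout (u : payoffs R n) : is_game u -> forall i : 'I_n,
      measurable_fun [set: ra_space A]%classic (fun w => output (Output (fun _ : 'I_n => 0 : R)) u i).
    by move=> _ i; exact: measurable_cst.
  have mnum (u : payoffs R n) : is_game u ->
      measurable_fun [set: ra_space A]%classic (fun w => num_queries (Output (fun _ : 'I_n => 0 : R)) u).
    by move=> _; exact: measurable_cst.
  exists (@RandAlgorithm R n _ _ (ra_prob A) _ mout mnum) => q _ u uC.
  by case: no; exists u.
(* If another player exists, [lam i] bounds a distance of payoffs; otherwise [lam i] is [Lambda]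
   itself. *)
have lam_ge0 i : 0 <= lam i.
  have [i' ne|none] := pickP (fun i' => i' != i).
    have := u_lam i i' [ffun=> ord0] [ffun=> ord0] ne (fun _ _ => erefl).
    by rewrite subrr normr0.
  by move: L0; rewrite -lamE (bigD1 i) //= big_pred0 ?addr0.
have Ln : Lambda <= n%:R.
  rewrite -lamE -[n in n%:R]card_ord -sumr_const.
  by apply: ler_sum => i _; exact: lam1.
have [small|large] := lerP Lambda (eps / 4).
  have [B HB] := small_reduction A n0 eta01 lam_ge0 lamE small.
  exists B => q /HB; apply: computes_nash_le.
  rewrite natrM; apply: ler_wpM2l; first exact: ler0n.
  apply: le_trans (query_bound n eps eta01).
  by rewrite ler_nat mulnCA leq_pmulr // muln_gt0.
have [B HB] := large_reduction A n0 eps0 eta01 lam_ge0 lamE large Ln.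
exists B => q /HB; apply: computes_nash_le.
rewrite natrM; apply: ler_wpM2l; first exact: ler0n.
exact: query_bound.
Qed.

(* Gives access to the ring structure of polynomials. *)
Import -(notations) mpoly.

Theorem theorem4 (R : realType) :
  exists P : mpoly.mpoly 3 R,
  forall (n : nat) (Lambda eps eta : R),
    (0 < n)%N -> 0 <= Lambda -> 0 < eps -> 0 < eta < 1 ->
    exists reduction :
        rand_algorithm R (2 * n) -> (('I_n -> R) -> rand_algorithm R n),
    forall (A : rand_algorithm R (2 * n)) (q : nat),
      computes_nash (lipschitz_game (3 * Lambda / (2 * n)%:R))
        (eps / 2) (eta / 2) q%:R A ->
      computes_nash_multi_lipschitz Lambda eps eta
        (q%:R * eval3 P n%:R (1 / eps) (ln (1 / eta))) (reduction A).
Proof.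
pose X (i : 'I_3) := mpolyX R (mnm1 i).
pose c (r : R) := mpolyC 3 r.
pose x := X (@Ordinal 3 0 isT); pose y := X (@Ordinal 3 1 isT).
pose z := X (@Ordinal 3 2 isT).
(* With [x], [y], [z] standing for [n], [1 / eps] and [ln (1 / eta)], this is the bound on the
   samples plus one, times the [2 * n] members. *)
exists (c 2 * x * (c 512 * (x * x) * (y * y) * (c 7 * x + z) + c 1)).
move=> n Lambda eps eta n0 L0 eps0 eta01.
(* Choice over pairs of an algorithm and constants turns the existence statement into a single map,
   fixed before [q]. *)
have /choice[f fP] := fun Al : rand_algorithm R (2 * n) * ('I_n -> R) =>
  reduction_exists Al.2 Al.1 n0 L0 eps0 eta01.
exists (fun A lam => f (A, lam)) => A q Aq lam.
have := fP (A, lam) q Aq; rewrite /eval3 /sample_bound.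
rewrite !(mevalM, mevalD, mevalC, mevalXU) !(tnth_nth 0).
by rewrite /= -!expr2.
Qed.
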